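(* Let $A_1,\dots,A_m\in S^n$, let $0<\delta_1\le\delta_2$ be constants, let $\|\cdot\|$ be a matrix norm on $\mathbb{R}^{n\times n}$, and let $$r^*=\min\left\{\operatorname{rank}(X):\ \langle A_i,X\rangle=0,\ i=1,\dots,m,\ \delta_1\le\|X\|\le\delta_2,\ X\succeq0\right\},$$ with $r^*=\infty$ if this problem is infeasible. Then $x=0$ is the only solution $x\in\mathbb{R}^n$ to the system $x^TA_ix=0$, $i=1,\dots,m$, if and only if $r^*\ge2$.
   Context: $S^n$ is the set of real symmetric $n\times n$ matrices, $\langle X,Y\rangle=\operatorname{tr}(X^TY)$, and $X\succeq0$ means $X\in S^n$ is positive semidefinite. *)

(* Defs.v *)
From HB Require Import structures.
From mathcomp Require Export all_boot all_order all_algebra.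
From mathcomp Require Export classical_sets reals ereal.
From mathcomp Require Import boolp.

Set Implicit Arguments.
Unset Strict Implicit.
Unset Printing Implicit Defensive.

Import Order.TTheory GRing.Theory Num.Theory.

Local Open Scope classical_set_scope.
Local Open Scope ring_scope.

(* A norm on the vector space of square matrices, with the axioms of the
   factory Lmodule_isNormed; nonnegativity and N 0 = 0 follow from them.
   Submultiplicativity is not required. *)
Record matrix_norm (R : realType) (n : nat) (N : 'M[R]_n -> R) : Prop :=
  MatrixNorm {
    matrix_normD : forall X Y, N (X + Y) <= N X + N Y;
    matrix_normZ : forall a X, N (a *: X) = `|a| * N X;
    matrix_norm0_eq0 : forall X, N X = 0 -> X = 0 }.

Definition mxinner (R : realType) (n : nat) (X Y : 'M[R]_n) : R :=
  \tr (X^T *m Y).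

Definition psdmx (R : realType) (n : nat) (X : 'M[R]_n) : Prop :=
  X \is symmetricmx /\ forall v : 'cV[R]_n, 0 <= (v^T *m X *m v) 0 0.

Definition feasible (R : realType) (m n : nat) (A : 'I_m -> 'M[R]_n)
    (N : 'M[R]_n -> R) (d1 d2 : R) : set 'M[R]_n :=
  [set X | [/\ forall i, mxinner (A i) X = 0, d1 <= N X <= d2 & psdmx X]].

(* The minimum is an infimum in the extended reals, so that it is +oo when the
   problem is infeasible; see rstar_infeasible and rstar_attained. *)
Definition rstar (R : realType) (m n : nat) (A : 'I_m -> 'M[R]_n)
    (N : 'M[R]_n -> R) (d1 d2 : R) : \bar R :=
  ereal_inf [set ((\rank X)%:R)%:E | X in feasible A N d1 d2].

Lemma rstar_infeasible (R : realType) (m n : nat) (A : 'I_m -> 'M[R]_n)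
    (N : 'M[R]_n -> R) (d1 d2 : R) :
  feasible A N d1 d2 = set0 -> rstar A N d1 d2 = +oo%E.
Proof. by rewrite /rstar => ->; rewrite image_set0 ereal_inf0. Qed.

Lemma rstar_attained (R : realType) (m n : nat) (A : 'I_m -> 'M[R]_n)
    (N : 'M[R]_n -> R) (d1 d2 : R) :
  feasible A N d1 d2 !=set0 ->
  exists2 X, feasible A N d1 d2 X &
    rstar A N d1 d2 = ((\rank X)%:R)%:E /\
    forall Y, feasible A N d1 d2 Y -> (\rank X <= \rank Y)%N.
Proof.
move=> [X0 FX0].
pose P k := `[< exists2 X, feasible A N d1 d2 X & \rank X = k >].
have exP : exists k, P k by exists (\rank X0); apply/asboolP; exists X0.
case: (ex_minnP exP) => k /asboolP[X FX <-] min_k; exists X => //.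
have le_rank Y : feasible A N d1 d2 Y -> (\rank X <= \rank Y)%N.
  by move=> FY; apply: min_k; apply/asboolP; exists Y.
split=> //; apply/le_anti/andP; split.
  by apply: ereal_inf_lbound; exists X.
apply: le_ereal_inf_tmp => _ [Y FY <-]; by rewrite lee_fin ler_nat le_rank.
Qed.

(* Main.v *)
(* A positive semidefinite matrix of rank one is x x^T with x a multiple of one
   of its columns, and <A_i, x x^T> = x^T A_i x.  Hence feasible matrices of
   rank one come from nonzero solutions x of the system, and conversely a
   nonzero solution x gives a feasible multiple of x x^T, whose norm is d1. *)
Require Import Defs.

Set Implicit Arguments.
Unset Strict Implicit.
Unset Printing Implicit Defensive.

Import Order.TTheory GRing.Theory Num.Theory.

Local Open Scope ring_scope.

Lemma matrix_norm0 (R : realType) (n : nat) (N : 'M[R]_n -> R) :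
  matrix_norm N -> N 0 = 0.
Proof. by move=> hN; rewrite -(scale0r 0) (matrix_normZ hN) normr0 mul0r. Qed.

Lemma matrix_norm_gt0 (R : realType) (n : nat) (N : 'M[R]_n -> R)
    (X : 'M[R]_n) : matrix_norm N -> X != 0 -> 0 < N X.
Proof.
move=> hN X0; rewrite lt_def; apply/andP; split.
  by apply: contraNneq X0 => /(matrix_norm0_eq0 hN) ->.
(* Nonnegativity: [0 = N (X - X) <= N X + N (- X) = 2 N X]. *)
have := matrix_normD hN X (-1 *: X).
rewrite (matrix_normZ hN) scaleN1r subrr (matrix_norm0 hN) normrN1 mul1r -mulr2n.
by rewrite pmulrn_lge0.
Qed.

Lemma symmetricmxP (F : fieldType) (n : nat) (X : 'M[F]_n) :
  reflect (X^T = X) (X \is symmetricmx).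
Proof.
rewrite is_hermitianmxE expr0 scale1r map_mx_id // eq_sym.
exact: eqP.
Qed.

Lemma rank1_factor (F : fieldType) (m n : nat) (X : 'M[F]_(m, n)) :
  \rank X = 1%N -> exists (u : 'cV[F]_m) (v : 'rV[F]_n), X = u *m v.
Proof.
move: (mulmx_base X); move: (col_base X) (row_base X) => + + + r1.
by rewrite r1 => u v <-; exists u, v.
Qed.

(** Cyclicity of the trace turns [A *m x *m x^T] into a 1x1 matrix. *)
Lemma mxinner_outer (R : realType) (n : nat) (A : 'M[R]_n) (x : 'cV[R]_n) :
  A \is symmetricmx -> mxinner A (x *m x^T) = (x^T *m A *m x) 0 0.
Proof.
move=> /symmetricmxP AT; rewrite /mxinner AT.
by rewrite mulmxA mxtrace_mulC mulmxA trace_mx11.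
Qed.

(** The diagonal of [x *m x^T] consists of the squares of the entries of [x]. *)
Lemma outer_eq0 (R : idomainType) (n : nat) (x : 'cV[R]_n) :
  (x *m x^T == 0) = (x == 0).
Proof.
apply/eqP/eqP => [xx0|->]; last by rewrite mul0mx.
apply/colP => i; move/matrixP/(_ i i): xx0.
by rewrite !mxE big_ord1 !mxE => /eqP; rewrite mulf_eq0 orbb => /eqP.
Qed.

Lemma psdmx_outer (R : realType) (n : nat) (a : R) (x : 'cV[R]_n) :
  0 <= a -> psdmx (a *: (x *m x^T)).
Proof.
move=> a0; split.
  by apply/symmetricmxP; rewrite linearZ /= trmx_mul trmxK.
move=> v; rewrite -scalemxAr -scalemxAl mxE mulr_ge0 //.
(* The form at [v] is the square of the scalar [v^T *m x], as [x^T *m v] is its transpose. *)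
rewrite mulmxA -(mulmxA (v^T *m x)) -[x^T *m v]trmxK trmx_mul trmxK.
by rewrite mxE big_ord1 [_^T _ _]mxE -expr2 sqr_ge0.
Qed.

Lemma psdmx_diag_ge0 (R : realType) (n : nat) (X : 'M[R]_n) (i : 'I_n) :
  psdmx X -> 0 <= X i i.
Proof.
case=> _ /(_ (delta_mx i 0)); congr (0 <= _).
by rewrite trmx_delta -rowE -colE !mxE.
Qed.

Lemma psdmx_rank1 (R : realType) (n : nat) (X : 'M[R]_n) :
  psdmx X -> \rank X = 1%N -> exists x : 'cV[R]_n, X = x *m x^T.
Proof.
move=> Xpsd r1; have [u [v Xuv]] := rank1_factor r1.
have XE i j : X i j = u i 0 * v 0 j by rewrite Xuv mxE big_ord1.
have Xsym i j : X i j = X j i.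
  by case: Xpsd => /symmetricmxP XT _; rewrite -{1}XT mxE.
(* Symmetry moves a nonzero entry to the diagonal: [X i j = u i * v j] gives [u i != 0], and
   [X j i = u j * v i] gives [v i != 0]. *)
have /matrix0Pn[i [j]] : X != 0 by rewrite -mxrank_eq0 r1.
move=> Xij0; have ui0 : u i 0 != 0.
  by apply: contraNneq Xij0 => u0; rewrite XE u0 mul0r.
have vi0 : v 0 i != 0.
  by apply: contraNneq Xij0 => v0; rewrite Xsym XE v0 mulr0.
have Xii0 : X i i != 0 by rewrite XE mulf_neq0.
(* By symmetry the claim becomes the vanishing of a 2x2 minor, [X i i * X k l = X k i * X i l],
   which is clear from [X = u *m v]. *)
exists ((Num.sqrt (X i i))^-1 *: col i X); apply/matrixP => k l.
rewrite mxE big_ord1 !mxE mulrACA -invfM -expr2 sqr_sqrtr ?psdmx_diag_ge0 //.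
apply: (mulfI Xii0); rewrite mulVKf // (Xsym l i) !XE.
by rewrite [RHS]mulrC mulrACA [RHS]mulrACA [v 0 l * _]mulrC.
Qed.

Theorem lemma4p1 (R : realType) (m n : nat) (A : 'I_m -> 'M[R]_n)
    (hA : forall i, A i \is symmetricmx)
    (d1 d2 : R) (hd1 : 0 < d1) (hd12 : d1 <= d2)
    (N : 'M[R]_n -> R) (hN : matrix_norm N) :
  (forall x : 'cV[R]_n, (forall i, x^T *m A i *m x = 0) <-> x = 0)
  <-> (2%:R%:E <= rstar A N d1 d2)%E.
Proof.
have quadE i (x : 'cV[R]_n) : mxinner (A i) (x *m x^T) = 0 <-> x^T *m A i *m x = 0.
  rewrite mxinner_outer //; split=> [q0|->]; last by rewrite mxE.
  by apply/matrixP => a b; rewrite !ord1 q0 mxE.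
split=> [sol0|rstar_ge2 x].
  apply: le_ereal_inf_tmp => _ [X [XA /andP[NX _] Xpsd] <-].
  rewrite lee_fin ler_nat.
  (* Rank 0 is excluded by [0 < d1 <= N X], so only rank 1 remains to be ruled out. *)
  have X0 : X != 0.
    by apply: contraTneq NX => ->; rewrite (matrix_norm0 hN) -ltNge.
  rewrite ltn_neqAle lt0n mxrank_eq0 X0 andbT eq_sym.
  apply/eqP => /(psdmx_rank1 Xpsd)[x Xx]; move: X0.
  rewrite Xx outer_eq0 => /eqP; apply; apply/sol0 => i.
  by apply/quadE; rewrite -Xx.
split=> [xA|-> i]; last by rewrite mulmx0.
apply/eqP; apply: contraT; rewrite -outer_eq0 => xx0.
have Nxx := matrix_norm_gt0 hN xx0; set X := x *m x^T in xx0 Nxx.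
have a0 : 0 <= d1 / N X by rewrite divr_ge0 ?ltW.
(* A feasible multiple of [x *m x^T] yields [2 <= 1]: its rank is at most that of [x^T], which has a
   single row. *)
suff /(le_trans rstar_ge2) :
    (rstar A N d1 d2 <= (\rank ((d1 / N X) *: X))%:R%:E)%E.
  rewrite lee_fin ler_nat => /leq_trans/(_ (mxrank_scale _ _)).
  by move/leq_trans/(_ (mxrankM_maxr _ _))/leq_trans/(_ (rank_leq_row _)).
apply: ereal_inf_lbound; exists ((d1 / N X) *: X) => //; split.
- move=> i; rewrite /mxinner -scalemxAr linearZ /=.
  by have /quadE := xA i; rewrite /mxinner => ->; rewrite mulr0.
- by rewrite (matrix_normZ hN) ger0_norm // divfK ?gt_eqF // lexx.
- exact: psdmx_outer.
Qed.
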